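(* Let $q=\zeta_N$ be a primitive $N$-th root of unity. Assume that $q^{d_k}$ is a primitive $N$-th root of unity for every $k\in I$, and that for every seed $\mathbf i$ (in the given equivalence class) the corresponding function $\varepsilon_{ij}$ satisfies $\gcd(2\varepsilon_{ij},N)=1$ for all $i,j$ with $\varepsilon_{ij}\neq0$. Then there exists a map of positive spaces, called the quantum Frobenius map, $$\mathbb F_N:\mathcal X_q\to\mathcal X\quad\text{such that}\quad\mathbb F_N^*(Y_i)=X_i^N$$ in any cluster coordinate system. That is, for every seed $\mathbf i$ the rule $Y_i\mapsto X_i^N$ defines a ring homomorphism from the Laurent polynomials in $\{Y_i\}$ to $\mathbf T_{\mathbf i}$ (with values in the center), and these homomorphisms intertwine the mutations of $\mathcal X$ with the quantum mutations of $\mathcal X_q$.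
   Context: A seed $\mathbf i=(I,I_0,\varepsilon,d)$ consists of a finite set $I$, a subset $I_0\subset I$ of frozen elements, a function $\varepsilon=(\varepsilon_{ij})$ on $I\times I$, and positive integers $\{d_i\}_{i\in I}$ with greatest common divisor $1$ such that $\widehat\varepsilon_{ij}:=\varepsilon_{ij}d_j^{-1}$ is skew-symmetric; here it is assumed that $\widehat\varepsilon_{ij}\in\mathbb Z$ for all $i,j$. For $k\in I\setminus I_0$ the mutated seed $\mathbf i'=\mu_k(\mathbf i)=(I,I_0,\varepsilon',d)$ is given by $\varepsilon'_{ij}=-\varepsilon_{ij}$ if $k\in\{i,j\}$; $\varepsilon'_{ij}=\varepsilon_{ij}$ if $k\notin\{i,j\}$ and $\varepsilon_{ik}\varepsilon_{kj}\le 0$; $\varepsilon'_{ij}=\varepsilon_{ij}+|\varepsilon_{ik}|\varepsilon_{kj}$ if $k\notin\{i,j\}$ and $\varepsilon_{ik}\varepsilon_{kj}>0$. Seeds related by mutations and isomorphisms are equivalent. Classical space. $\{Y_i\}$ are the cluster coordinates on the seed torus $\mathcal X_{\mathbf i}$ of $\mathcal X$, and mutations act by $\mu_k^*Y'_k=Y_k^{-1}$, $\mu_k^*Y'_i=Y_i(1+Y_k^{-\mathrm{sgn}(\varepsilon_{ik})})^{-\varepsilon_{ik}}$ for $i\neq k$. Quantum space. $\mathbf T_{\mathbf i}$ is the algebra generated by $X_i^{\pm1}$, $i\in I$, with relations $q^{-\widehat\varepsilon_{ij}}X_iX_j=q^{-\widehat\varepsilon_{ji}}X_jX_i$, and $\mathbb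 T_{\mathbf i}$ is its fraction field. Put $q_k=q^{1/d_k}$; when $q$ is the root of unity above, $q_k$ is the $N$-th root of unity with $q_k^{d_k}=q$ (it exists, is unique and is a primitive $N$-th root of unity since $q^{d_k}$ is primitive). The quantum mutation $\mu_k^q:\mathbb T_{\mathbf i'}\to\mathbb T_{\mathbf i}$ (conjugation by the quantum dilogarithm of $X_k$ for generic $q$, then specialized) is $X'_k\mapsto X_k^{-1}$ and, for $i\neq k$, $$X'_i\mapsto X_i\prod_{a=1}^{|\varepsilon_{ik}|}(1+q_k^{2a-1}X_k)\ \text{ if }\varepsilon_{ik}\le0,\qquad X'_i\mapsto X_i\Bigl(\prod_{a=1}^{\varepsilon_{ik}}(1+q_k^{2a-1}X_k^{-1})\Bigr)^{-1}\ \text{ if }\varepsilon_{ik}\geq0.$$ Intertwining means $\mu_k^q\bigl((X'_i)^N\bigr)=\mathbb F_N^*(\mu_k^*Y'_i)$ for all $i$ and $k$. *)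

(* Defs.v *)
From HB Require Import structures.
From mathcomp Require Import all_boot all_order all_algebra.
From mathcomp Require Import finmap.
From mathcomp Require Import monalg.
From mathcomp Require Import zify ring.

Set Implicit Arguments.
Unset Strict Implicit.
Unset Printing Implicit Defensive.

Import Order.TTheory GRing.Theory Num.Theory.

Local Open Scope ring_scope.

(* Since epsilon-hat_{ij} = eps_{ij} / d_j is required to be an integer, eps
   itself is integer valued; [seed_div] is that integrality requirement, so the
   quotients in [seed_skew] and in [epsh] are exact. *)
Record seed := Seed {
  idx : finType;
  frozen : {set idx};
  eps : idx -> idx -> int;
  mult : idx -> nat;
  mult_gt0 : forall i, (0 < mult i)%N;
  mult_gcd : \big[gcdn/0%N]_(i : idx) mult i = 1%N;
  seed_div : forall i j, ((mult j)%:Z %| eps i j)%Z;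
  seed_skew : forall i j,
    (eps i j %/ (mult j)%:Z)%Z = - (eps j i %/ (mult i)%:Z)%Z }.

Arguments frozen : clear implicits.
Arguments mult : clear implicits.
Arguments eps : clear implicits.

Definition epsh (s : seed) (i j : idx s) : int :=
  (eps s i j %/ (mult s j)%:Z)%Z.

Arguments epsh : clear implicits.

Lemma epsE (s : seed) (i j : idx s) : eps s i j = epsh s i j * (mult s j)%:Z.
Proof. by rewrite /epsh divzK // seed_div. Qed.

Lemma epsh_skew (s : seed) (i j : idx s) : epsh s i j = - epsh s j i.
Proof. exact: seed_skew. Qed.

Definition mut_eps (s : seed) (k i j : idx s) : int :=
  if (i == k) || (j == k) then - eps s i j
  else if eps s i k * eps s k j <= 0 then eps s i j
  else eps s i j + `|eps s i k| * eps s k j.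

Lemma mut_eps_div (s : seed) (k i j : idx s) :
  ((mult s j)%:Z %| mut_eps k i j)%Z.
Proof.
rewrite /mut_eps; case: ifP => _; first by rewrite rpredN seed_div.
case: ifP => _; first exact: seed_div.
by rewrite rpredD ?dvdz_mull ?seed_div.
Qed.

Lemma mut_eps_skew (s : seed) (k i j : idx s) :
  (mut_eps k i j %/ (mult s j)%:Z)%Z = - (mut_eps k j i %/ (mult s i)%:Z)%Z.
Proof.
have d_gt0 l : (0 : int) < (mult s l)%:Z by rewrite ltz_nat mult_gt0.
have d_neq0 l : (mult s l)%:Z != 0 by rewrite gt_eqF.
have eN l m : eps s l m = epsh s l m * (mult s m)%:Z by exact: epsE.
have HN l m : epsh s l m = - epsh s m l by exact: epsh_skew.
have sgn l m n : (eps s l m * eps s m n <= 0) = (epsh s l m * epsh s m n <= 0).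
  by rewrite !eN mulrACA pmulr_lle0 // mulr_gt0.
rewrite /mut_eps orbC; case: ifP => _.
  by rewrite !eN -!mulNr !mulzK // HN.
rewrite !sgn (HN j k) (HN k i) mulrNN mulrC.
case: ifP => pos; first by rewrite !eN !mulzK // HN.
rewrite !eN !normrM (HN i j).
rewrite !(gtr0_norm (d_gt0 k)) !mulrA -!mulrDl !mulzK //.
move: pos; rewrite (HN i k) (HN j k) !normrN.
move: (epsh s k i) (epsh s k j) (mult s k) (epsh s j i) => a b m c.
by nia.
Qed.

(* Defined for every k; the frozen directions are excluded where mutation is
   used. *)
Definition mutate (s : seed) (k : idx s) : seed :=
  @Seed (idx s) (frozen s) (@mut_eps s k) (mult s)
    (@mult_gt0 s) (mult_gcd s) (@mut_eps_div s k) (@mut_eps_skew s k).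

Definition seed_iso (s t : seed) (f : idx s -> idx t) : Prop :=
  [/\ bijective f,
      forall i, (f i \in frozen t) = (i \in frozen s),
      forall i j, eps t (f i) (f j) = eps s i j
    & forall i, mult t (f i) = mult s i].

Inductive seed_equiv (s : seed) : seed -> Prop :=
| seed_equiv_refl : seed_equiv s s
| seed_equiv_mut t (k : idx t) :
    seed_equiv s t -> k \notin frozen t -> seed_equiv s (mutate k)
| seed_equiv_iso t u (f : idx t -> idx u) :
    seed_equiv s t -> seed_iso f -> seed_equiv s u.

(* The algebra on generators X_i^{+-1} with q^{-L i j} X_i X_j =
   q^{-L j i} X_j X_i, for L skew-symmetric, realized on its monomial basis
   (e_v), v in Z^I, with e_v e_w = q^{sum_ij L i j v_i w_j} e_{v+w} and
   X_i = e_{delta_i}.  [qX_rel], [qXV], [qtorus_univ] and [qtorus_ext] show that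
   it has the universal property of this presentation. *)

Section QTorus.
Variables (R : comUnitRingType) (q : R) (qU : q \is a GRing.unit).
Variables (I : finType) (L : I -> I -> int).

Local Notation K := {ffun I -> int}.

Definition qform (v w : K) : int := \sum_i \sum_j L i j * v i * w j.

Lemma qformDl v1 v2 w : qform (v1 + v2) w = qform v1 w + qform v2 w.
Proof.
rewrite -big_split /=; apply: eq_bigr => i _; rewrite -big_split /=.
by apply: eq_bigr => j _; rewrite ffunE; ring.
Qed.

Lemma qformDr v w1 w2 : qform v (w1 + w2) = qform v w1 + qform v w2.
Proof.
rewrite -big_split /=; apply: eq_bigr => i _; rewrite -big_split /=.
by apply: eq_bigr => j _; rewrite ffunE; ring.
Qed.

Lemma qform0l w : qform 0 w = 0.
Proof. by rewrite /qform big1 // => i _; rewrite big1 // => j _; rewrite ffunE mulr0 mul0r. Qed.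

Lemma qform0r v : qform v 0 = 0.
Proof. by rewrite /qform big1 // => i _; rewrite big1 // => j _; rewrite ffunE mulr0. Qed.

Definition qtorus of q \is a GRing.unit & I -> I -> int := {malg R[K]}.
Local Notation T := (qtorus qU L).

HB.instance Definition _ := GRing.Lmodule.on T.

Implicit Types g : {malg R[K]}.

Definition qterm (g1 g2 : {malg R[K]}) (v w : K) : {malg R[K]} :=
  << g1@_v * g2@_w * q ^ qform v w *g v + w >>.

Definition qmul g1 g2 : {malg R[K]} :=
  \sum_(v <- msupp g1) \sum_(w <- msupp g2) qterm g1 g2 v w.

Lemma qmullw (d1 d2 : {fset K}) g1 g2 :
  (msupp g1 `<=` d1)%fset -> (msupp g2 `<=` d2)%fset ->
  qmul g1 g2 = \sum_(v <- d1) \sum_(w <- d2) qterm g1 g2 v w.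
Proof.
move=> le_d1 le_d2; rewrite /qmul (big_fset_incl _ le_d1) /=.
  apply/eq_bigr=> k1 _; apply/big_fset_incl => // k _ /mcoeff_outdom g0.
  by rewrite /qterm g0 mulr0 mul0r monalgU0.
move=> k _ /mcoeff_outdom g1k; rewrite big1 // => k' _.
by rewrite /qterm g1k !mul0r monalgU0.
Qed.

Lemma qmulrw (d1 d2 : {fset K}) g1 g2 :
  (msupp g1 `<=` d1)%fset -> (msupp g2 `<=` d2)%fset ->
  qmul g1 g2 = \sum_(w <- d2) \sum_(v <- d1) qterm g1 g2 v w.
Proof. by move=> le1 le2; rewrite (qmullw le1 le2) exchange_big. Qed.

Lemma qmul0g : left_zero 0 qmul.
Proof. by move=> g; rewrite /qmul msupp0 big_seq_fset0. Qed.

Lemma qmulg0 : right_zero 0 qmul.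
Proof. by move=> g; rewrite /qmul big1 // => v _; rewrite msupp0 big_seq_fset0. Qed.

Lemma qmulUU c1 c2 v w :
  qmul << c1 *g v >> << c2 *g w >> = << c1 * c2 * q ^ qform v w *g v + w >>.
Proof. by rewrite (qmulrw msuppU_le msuppU_le) !big_seq_fset1 /qterm !mcoeffUU. Qed.

Lemma qmulUg c v g : qmul << c *g v >> g =
  \sum_(w <- msupp g) << c * g@_w * q ^ qform v w *g v + w >>.
Proof.
rewrite (qmullw msuppU_le (fsubset_refl _)) big_seq_fset1.
by apply/eq_bigr => w _; rewrite /qterm mcoeffUU.
Qed.

Lemma qmulgU c w g : qmul g << c *g w >> =
  \sum_(v <- msupp g) << g@_v * c * q ^ qform v w *g v + w >>.
Proof.
rewrite (qmulrw (fsubset_refl _) msuppU_le) big_seq_fset1.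
by apply/eq_bigr => v _; rewrite /qterm mcoeffUU.
Qed.

Lemma qmulEl g1 g2 :
  qmul g1 g2 = \sum_(v <- msupp g1) qmul << g1@_v *g v >> g2.
Proof. by apply/eq_bigr=> k _; rewrite qmulUg. Qed.

Lemma qmulEr g1 g2 :
  qmul g1 g2 = \sum_(w <- msupp g2) qmul g1 << g2@_w *g w >>.
Proof.
by rewrite {1}/qmul exchange_big; apply/eq_bigr=> k _; rewrite qmulgU.
Qed.

Lemma qmulDl : left_distributive qmul +%R.
Proof.
move=> g1 g2 g; rewrite (qmullw (msuppD_le g1 g2) (fsubset_refl _)).
rewrite (qmullw (fsubsetUl _ (msupp g2)) (fsubset_refl (msupp g))).
rewrite (qmullw (fsubsetUr (msupp g1) _) (fsubset_refl (msupp g))).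
rewrite -big_split /=; apply/eq_bigr=> k1 _.
rewrite -big_split /=; apply/eq_bigr=> k2 _.
by rewrite /qterm mcoeffD !mulrDl monalgUD.
Qed.

Lemma qmulDr : right_distributive qmul +%R.
Proof.
move=> g g1 g2; rewrite (qmullw (fsubset_refl _) (msuppD_le g1 g2)).
rewrite (qmullw (fsubset_refl (msupp g)) (fsubsetUl _ (msupp g2))).
rewrite (qmullw (fsubset_refl (msupp g)) (fsubsetUr (msupp g1) _)).
rewrite -big_split /=; apply/eq_bigr=> k1 _.
rewrite -big_split /=; apply/eq_bigr=> k2 _.
by rewrite /qterm mcoeffD mulrDr mulrDl monalgUD.
Qed.

Lemma qmulA : associative qmul.
Proof.
move=> g1 g2 g3.
rewrite [RHS](big_morph (qmul^~ _) (fun _ _ => qmulDl _ _ _) (qmul0g _)).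
rewrite qmulEl; apply/eq_bigr=> k1 _.
rewrite [LHS](big_morph (qmul _) (fun _ _ => qmulDr _ _ _) (qmulg0 _)).
rewrite [RHS](big_morph (qmul^~ _) (fun _ _ => qmulDl _ _ _) (qmul0g _)).
apply/eq_bigr=> k2 _.
rewrite [LHS](big_morph (qmul _) (fun _ _ => qmulDr _ _ _) (qmulg0 _)).
rewrite qmulEr; apply/eq_bigr=> k3 _; rewrite !qmulUU addrA.
by rewrite qformDl qformDr !(exprzDr qU); congr (<< _ *g _ >>); ring.
Qed.

Definition qone : {malg R[K]} := << 1 *g 0 >>.

Lemma qmul1g : left_id qone qmul.
Proof.
move=> g; rewrite qmulUg [RHS]monalgE; apply/eq_bigr=> w _.
by rewrite mul1r qform0l expr0z mulr1 add0r.
Qed.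

Lemma qmulg1 : right_id qone qmul.
Proof.
move=> g; rewrite qmulgU [RHS]monalgE; apply/eq_bigr=> w _.
by rewrite mulr1 qform0r expr0z mulr1 addr0.
Qed.

Lemma qone_neq0 : qone != 0.
Proof. by rewrite monalgU_eq0 oner_eq0. Qed.

HB.instance Definition _ := GRing.Zmodule_isNzRing.Build T
  qmulA qmul1g qmulg1 qmulDl qmulDr qone_neq0.

Lemma qscaleU (a c : R) v : a *: (<< c *g v >> : {malg R[K]}) = << a * c *g v >>.
Proof. by apply/malgP => w; rewrite mcoeffZ !mcoeffU mulrnAr. Qed.

Lemma qscaleAl (a : R) (g1 g2 : T) : a *: (g1 * g2) = (a *: g1) * g2.
Proof.
change (a *: qmul g1 g2 = qmul (a *: (g1 : {malg R[K]})) g2).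
rewrite (qmullw (msuppZ_le a g1) (fsubset_refl (msupp g2))) scaler_sumr.
apply: eq_bigr => v _; rewrite scaler_sumr; apply: eq_bigr => w _.
by rewrite /qterm mcoeffZ qscaleU !mulrA.
Qed.

HB.instance Definition _ := GRing.Lmodule_isLalgebra.Build R T qscaleAl.

Lemma qscaleAr (a : R) (g1 g2 : T) : a *: (g1 * g2) = g1 * (a *: g2).
Proof.
change (a *: qmul g1 g2 = qmul g1 (a *: (g2 : {malg R[K]}))).
rewrite (qmullw (fsubset_refl (msupp g1)) (msuppZ_le a g2)) scaler_sumr.
apply: eq_bigr => v _; rewrite scaler_sumr; apply: eq_bigr => w _.
by rewrite /qterm mcoeffZ qscaleU; congr (<< _ *g _ >>); ring.
Qed.

HB.instance Definition _ := GRing.Lalgebra_isAlgebra.Build R T qscaleAr.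

Definition qE (v : K) : T := << 1 *g v >> : {malg R[K]}.

Definition qdelta (i : I) : K := [ffun j => (j == i)%:Z].

Definition qX (i : I) : T := qE (qdelta i).

Lemma qE0 : qE 0 = 1. Proof. by []. Qed.

Lemma qEM v w : qE v * qE w = q ^ qform v w *: qE (v + w).
Proof.
change (qmul (qE v) (qE w) = q ^ qform v w *: (qE (v + w) : {malg R[K]})).
by rewrite qmulUU qscaleU !mul1r mulr1.
Qed.

Lemma qform_delta i j : qform (qdelta i) (qdelta j) = L i j.
Proof.
rewrite /qform (bigD1 i) //= [X in _ + X]big1 ?addr0 => [|l /negPf li].
  rewrite (bigD1 j) //= [X in _ + X]big1 ?addr0 => [|m /negPf mj].
    by rewrite !ffunE !eqxx !mulr1.
  by rewrite !ffunE mj mulr0.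
by rewrite big1 // => m _; rewrite !ffunE li mulr0 mul0r.
Qed.

Lemma qX_rel i j :
  q ^ (- L i j) *: (qX i * qX j) = q ^ (- L j i) *: (qX j * qX i).
Proof.
by rewrite !qEM !qform_delta !scalerA -!(exprzDr qU) !addNr [qdelta j + _]addrC.
Qed.

Hypothesis Lskew : forall i j, L i j = - L j i.

Lemma qform_alt v : qform v v = 0.
Proof.
have : qform v v = - qform v v.
  rewrite {1}/qform exchange_big -sumrN; apply: eq_bigr => i _.
  by rewrite -sumrN; apply: eq_bigr => j _; rewrite Lskew; ring.
by lia.
Qed.

Lemma qform_N v w : qform v (- w) = - qform v w.
Proof.
by apply/eqP; rewrite -addr_eq0 -qformDr addNr qform0r.
Qed.

Lemma qEV v : qE v * qE (- v) = 1 /\ qE (- v) * qE v = 1.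
Proof.
split; rewrite qEM ?subrr ?addNr.
  by rewrite qform_N qform_alt expr0z scale1r.
have -> : qform (- v) v = - qform (- v) (- v) by rewrite qform_N opprK.
by rewrite qform_alt oppr0 expr0z scale1r.
Qed.

Lemma qXV i : exists y : T, qX i * y = 1 /\ y * qX i = 1.
Proof. by exists (qE (- qdelta i)); apply: qEV. Qed.

Lemma qtorus_sumE (g : T) :
  g = \sum_(v <- msupp (g : {malg R[K]})) (g : {malg R[K]})@_v *: qE v.
Proof.
rewrite {1}[g](monalgE (g : {malg R[K]})); apply: eq_bigr => v _.
by rewrite qscaleU mulr1.
Qed.

Section Universal.
Variables (S : unitRingType) (f : {rmorphism R -> S}) (x : I -> S).
Hypothesis f_central : forall c y, f c * y = y * f c.
Hypothesis xU : forall i, x i \is a GRing.unit.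
Hypothesis x_rel : forall i j,
  f (q ^ (- L i j)) * (x i * x j) = f (q ^ (- L j i)) * (x j * x i).

Let u := f q.
Let uU : u \is a GRing.unit. Proof. exact: rmorph_unit. Qed.
Let fz n : f (q ^ n) = u ^ n.
Proof. by rewrite rmorphXz. Qed.
Let uC n y : u ^ n * y = y * u ^ n.
Proof. by rewrite -fz f_central. Qed.

Let uCA n y z : y * (u ^ n * z) = u ^ n * (y * z).
Proof. by rewrite !mulrA uC. Qed.
Let uM m n z : u ^ m * (u ^ n * z) = u ^ (m + n) * z.
Proof. by rewrite mulrA -exprzDr. Qed.

Let xC i j : x j * x i = u ^ (- 2 * L i j) * (x i * x j).
Proof.
have := x_rel i j; rewrite !fz (Lskew j i) opprK => /(congr1 ( *%R (u ^ (- L i j)))).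
by rewrite !mulrA -!exprzDr // addNr expr0z mul1r => <-; congr (u ^ _ * _ * _); ring.
Qed.

Let skewX (a b c : S) (n : nat) : c \is a GRing.unit ->
  (forall y, c * y = y * c) -> b * a = c * (a * b) ->
  b * a ^+ n = c ^+ n * (a ^+ n * b).
Proof.
move=> cU cC ba; elim: n => [|n IH]; first by rewrite !expr0 mulr1 !mul1r.
rewrite (exprSr a) mulrA IH -!mulrA ba (mulrA _ c) -(cC (a ^+ n)).
by rewrite (exprSr c) !mulrA.
Qed.

Let skewXz (a b : S) m (n : int) : a \is a GRing.unit ->
  b * a = u ^ m * (a * b) -> b * a ^ n = u ^ (m * n) * (a ^ n * b).
Proof.
move=> aU ba.
have cU l : u ^ l \is a GRing.unit by exact: unitrXz.
case: n => n.
  by rewrite -exprz_exp -!exprnP; apply: skewX => // y; rewrite uC.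
have ba' : b * a^-1 = u ^ (- m) * (a^-1 * b).
  apply: (mulIr aU); rewrite -!mulrA mulVr // mulr1 ba.
  by rewrite (mulrA a^-1) -(uC m) -!mulrA mulKr // mulrA -exprzDr // addNr mul1r.
have -> : m * Negz n = - m * n.+1%:Z by rewrite NegzE mulrN mulNr.
have -> : a ^ Negz n = a^-1 ^+ n.+1 by rewrite exprVn.
by rewrite -exprz_exp -exprnP; apply: skewX => // y; rewrite uC.
Qed.

Let skewXl (a b : S) m (n : int) : b \is a GRing.unit ->
  b * a = u ^ m * (a * b) -> b ^ n * a = u ^ (m * n) * (a * b ^ n).
Proof.
move=> bU ba.
have ab : a * b = u ^ (- m) * (b * a).
  by rewrite ba mulrA -exprzDr // addNr mul1r.
by rewrite (skewXz n bU ab) mulrA -exprzDr // mulNr subrr mul1r.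
Qed.

Let bb (s : seq I) i (v : K) : int := \sum_(j <- s) L i j * v j.

Let BB (s : seq I) (v w : K) : int :=
  \sum_(i <- s) \sum_(j <- s) L i j * v i * w j.

Fixpoint qordered (s : seq I) (v : K) : S :=
  if s is i :: s' then
    u ^ (- (v i * \sum_(j <- s') L i j * v j)) * (x i ^ v i * qordered s' v)
  else 1.
Local Notation hh := qordered.

Let hx s v i n :
  hh s v * x i ^ n = u ^ (- 2 * n * bb s i v) * (x i ^ n * hh s v).
Proof.
elim: s => [|j s IH] /=; first by rewrite /bb big_nil mulr0 expr0z !mul1r mulr1.
have xx := skewXz n (xU i) (skewXl (v j) (xU j) (xC i j)).
rewrite -!mulrA IH (uCA _ (x j ^ _)) (mulrA (x j ^ _)) xx -!mulrA.
rewrite (uCA _ (x i ^ _)) !uM; congr (u ^ _ * _).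
by rewrite /bb big_cons; ring.
Qed.

Let BBcons i s v w :
  BB (i :: s) v w = BB s v w + v i * bb s i w - w i * bb s i v.
Proof.
have Lii : L i i = 0 by have := Lskew i i; lia.
have e1 : \sum_(j <- s) L i j * v i * w j = v i * bb s i w.
  by rewrite /bb mulr_sumr; apply: eq_bigr => j _; ring.
have e2 : \sum_(l <- s) L l i * v l * w i = - (w i * bb s i v).
  by rewrite /bb mulr_sumr -sumrN; apply: eq_bigr => j _; rewrite (Lskew j); ring.
rewrite /BB !big_cons; under [X in _ + X = _]eq_bigr do rewrite big_cons.
by rewrite big_split /= e1 e2 Lii; ring.
Qed.

Let hhM s v w : hh s v * hh s w = u ^ BB s v w * hh s (v + w).
Proof.
elim: s => [|i s IH] /=; first by rewrite /BB big_nil expr0z !mul1r.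
rewrite -!mulrA (uCA _ (hh s v)) (mulrA (hh s v)) hx -!mulrA IH.
rewrite !(uCA _ (x i ^ _)) (mulrA (x i ^ _)) -exprzDr // ffunE !uM.
congr (u ^ _ * _); rewrite BBcons -/(bb s i v) -/(bb s i w).
have -> : \sum_(j <- s) L i j * (v + w) j = bb s i v + bb s i w.
  by rewrite -big_split /=; apply: eq_bigr => j _; rewrite ffunE; ring.
by ring.
Qed.

Lemma qtorus_univ : exists g : {rmorphism T -> S},
  (forall c : R, g c%:A = f c) /\ forall i, g (qX i) = x i.
Proof.
pose h := hh (enum I); pose G := mmap f h : T -> S.
have GU c v : G (<< c *g v >> : {malg R[K]}) = f c * h v by rewrite /G mmapU.
have BBE v w : BB (enum I) v w = qform v w.
  rewrite /BB /qform !big_enum; apply: eq_bigr => i _.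
  by rewrite big_enum.
have h0 : h 0 = 1.
  rewrite /h; elim: (enum I) => //= i s ->.
  by rewrite ffunE mul0r oppr0 !expr0z !mul1r.
have hdelta i : h (qdelta i) = x i.
  have hn s : i \notin s -> hh s (qdelta i) = 1.
    elim: s => //= j s IH; rewrite inE negb_or eq_sym => /andP[/negPf ji] /IH ->.
    by rewrite ffunE ji mul0r oppr0 !expr0z !mul1r.
  have: i \in enum I by rewrite mem_enum.
  rewrite /h; elim: (enum I) (enum_uniq I) => //= j s IH /andP[js us].
  rewrite inE; case: (eqVneq j i) js => [-> js _|ji js /= /(IH us) ->].
    rewrite (hn s js) ffunE eqxx mulr1 expr1z mul1r big1_seq ?oppr0 ?expr0z ?mul1r //.
    move=> l /andP[_ ls]; rewrite ffunE; case: eqP => [li|]; last by rewrite mulr0.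
    by move: js; rewrite -li ls.
  by rewrite ffunE (negPf ji) mul0r oppr0 !expr0z !mul1r.
have GM : monoid_morphism G.
  split; first by rewrite (GU 1 0) h0 mulr1 rmorph1.
  move=> g1 g2; change (mmap f h (qmul g1 g2) = mmap f h g1 * mmap f h g2).
  rewrite /qmul raddf_sum [in RHS]mmapE mulr_suml; apply: eq_bigr => v _.
  rewrite raddf_sum [in RHS]mmapE mulr_sumr; apply: eq_bigr => w _.
  rewrite /qterm /= mmapU /= !rmorphM fz -BBE -!mulrA -hhM.
  by rewrite (mulrA (f _) (hh _ v)) f_central !mulrA.
have GB : zmod_morphism G by move=> g1 g2; exact: (raddfB (mmap f h)).
pose GAdd := GRing.isZmodMorphism.Build T S G GB.
pose GMul := GRing.isMonoidMorphism.Build T S G GM.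
pose g : {rmorphism T -> S} := HB.pack G GAdd GMul.
exists g; split=> [c|i]; last by rewrite /= (GU 1) rmorph1 mul1r hdelta.
by rewrite /= -qE0 /qE qscaleU GU h0 !mulr1.
Qed.

End Universal.

Lemma qtorus_ext (S : nzRingType) (g1 g2 : {rmorphism T -> S}) :
  (forall c : R, g1 c%:A = g2 c%:A) -> (forall i, g1 (qX i) = g2 (qX i)) ->
  g1 =1 g2.
Proof.
move=> eqC eqX; pose P v := g1 (qE v) = g2 (qE v).
have PD v w : P v -> P w -> P (v + w).
  move=> Pv Pw; rewrite /P.
  have -> : qE (v + w) = (q ^ (- qform v w))%:A * (qE v * qE w).
    by rewrite qEM -scalerAl mul1r scalerA -exprzDr // addNr scale1r.
  by rewrite !rmorphM Pv Pw eqC.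
have PN v : P v -> P (- v).
  move=> Pv; rewrite /P; have [vN Nv] := qEV v.
  rewrite -[LHS]mulr1 -(rmorph1 g2) -vN rmorphM -Pv mulrA -rmorphM Nv.
  by rewrite rmorph1 mul1r.
have P0 : P 0 by rewrite /P qE0 !rmorph1.
have Pn v n : P v -> P (v *+ n).
  by move=> Pv; elim: n => [|n IH]; rewrite ?mulr0n // mulrS; apply: PD.
have Pz v (n : int) : P v -> P (v *~ n).
  by case: n => n Pv; [exact: Pn | rewrite NegzE mulrNz; apply/PN/Pn].
have PA v : P v.
  have -> : v = \sum_i qdelta i *~ v i.
    apply/ffunP => j; rewrite sum_ffunE (bigD1 j) //= big1 => [|i /negPf ij].
      by rewrite addr0 ffunMzE ffunE eqxx intz.
    by rewrite ffunMzE ffunE eq_sym ij mul0rz.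
  by elim/big_ind: _ => // i _; apply/Pz/eqX.
move=> g; rewrite (qtorus_sumE g) !rmorph_sum; apply: eq_bigr => v _.
by rewrite -[qE v]mul1r scalerAl !rmorphM eqC PA.
Qed.

End QTorus.

Definition zero_form (I : finType) (_ _ : I) : int := 0.

(* For L = 0 the twisting is trivial: this is the group algebra of Z^I, i.e.
   the ring of Laurent polynomials. *)
Notation laurent R I := (qtorus (unitr1 R) (@zero_form I)).

Definition lY (R : comUnitRingType) (I : finType) (i : I) : laurent R I :=
  qX (unitr1 R) (@zero_form I) i.

Lemma laurent_mulC (R : comUnitRingType) (I : finType) (f g : laurent R I) :
  f * g = g * f.
Proof.
rewrite (qtorus_sumE f) (qtorus_sumE g) !mulr_suml.
under eq_bigr do rewrite mulr_sumr.
rewrite exchange_big /=; apply: eq_bigr => w _.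
rewrite mulr_sumr; apply: eq_bigr => v _.
rewrite -!scalerAl -!scalerAr !qEM !exp1rz !scale1r [v + w]addrC !scalerA.
by rewrite mulrC.
Qed.

(* D is a (possibly noncommutative) field of fractions of A: a division ring
   containing A all of whose elements are fractions a b^-1.  Such a D is unique
   up to a unique isomorphism over A. *)
Definition is_fraction_field (A : nzRingType) (D : unitRingType)
    (iota : {rmorphism A -> D}) : Prop :=
  [/\ injective iota,
      forall x : D, x != 0 -> x \is a GRing.unit
    & forall x : D, exists a b : A, b != 0 /\ x = iota a / iota b].

Lemma prim_unit (R : idomainType) (N : nat) (q : R) :
  N.-primitive_root q -> q \is a GRing.unit.
Proof.
move=> qP; rewrite -(unitrX_pos _ (prim_order_gt0 qP)).
by rewrite (prim_expr_order qP) unitr1.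
Qed.

Lemma prim_root_tofrac (R : idomainType) (N : nat) (q : R) :
  N.-primitive_root q -> N.-primitive_root (tofrac q).
Proof.
move=> qP; apply/andP; split; first exact: prim_order_gt0 qP.
case/andP: qP => _ /forallP qP; apply/forallP => i; rewrite -(eqP (qP i)).
apply/eqP; rewrite !unity_rootE -rmorphXn -(rmorph1 (@tofrac R)).
exact: tofrac_eq.
Qed.

Lemma prim_rootP_idom (R : idomainType) (N : nat) (q z : R) :
  N.-primitive_root q -> z ^+ N = 1 -> exists i : 'I_N, z = q ^+ i.
Proof.
move=> /prim_root_tofrac qP zN.
have zN' : (tofrac z) ^+ N = 1 by rewrite -rmorphXn zN rmorph1.
have [i zi] := prim_rootP qP zN'; exists i; apply/eqP.
by rewrite -tofrac_eq rmorphXn zi.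
Qed.

(* q^{1/d}: the N-th root of unity whose d-th power is q; see [qrootP]. *)
Definition qroot (R : idomainType) (N : nat) (q : R) (d : nat) : R :=
  if [pick e : 'I_N | q ^+ (e * d) == q] is Some e then q ^+ e else q.

Lemma qrootP (R : idomainType) (N : nat) (q : R) (d : nat) :
  N.-primitive_root q -> N.-primitive_root (q ^+ d) ->
  [/\ qroot N q d ^+ N = 1, qroot N q d ^+ d = q
    & forall z : R, z ^+ N = 1 -> z ^+ d = q -> z = qroot N q d].
Proof.
move=> qP qdP; rewrite /qroot; case: pickP => [e /eqP qe|noe].
  rewrite exprAC (prim_expr_order qP) expr1n -exprM qe; split=> // z zN zd.
  have [e' ze'] := prim_rootP_idom qP zN.
  rewrite ze'.
  have : (q ^+ d) ^+ e' == (q ^+ d) ^+ e.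
    by rewrite exprAC -ze' zd -exprM mulnC qe.
  by rewrite (eq_prim_root_expr qdP) => ee; apply/eqP; rewrite (eq_prim_root_expr qP).
have [e qe] := prim_rootP_idom qdP (prim_expr_order qP).
by move: (noe e); rewrite mulnC exprM -qe eqxx.
Qed.

Notation qtorus_of qP s := (qtorus (prim_unit qP) (epsh s)).

Notation qX_of qP s := (qX (prim_unit qP) (epsh s)).

(* The pull-back of the i-th coordinate of [mutate k] on the seed torus of s,
   as an element of its function field. *)
Definition cmut (R : idomainType) (s : seed) (k : idx s) (K : fieldType)
    (iota : {rmorphism laurent R (idx s) -> K}) (i : idx s) : K :=
  let y j := iota (lY R j) in
  if i == k then (y k)^-1
  else y i * (1 + y k ^ (- sgz (eps s i k))) ^ (- eps s i k).

Section QuantumMutation.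
Variables (R : idomainType) (N : nat) (q : R) (qP : N.-primitive_root q).
Variables (s : seed) (k : idx s).
Variables (D : unitRingType) (iota : {rmorphism qtorus_of qP s -> D}).

Definition qmut (i : idx s) : D :=
  let x j := iota (qX_of qP s j) in
  let qk := iota (qroot N q (mult s k))%:A in
  let m := `|eps s i k|%N in
  if i == k then (x k)^-1
  else if eps s i k <= 0 then
    x i * \prod_(1 <= a < m.+1) (1 + qk ^+ (2 * a - 1) * x k)
  else x i * (\prod_(1 <= a < m.+1) (1 + qk ^+ (2 * a - 1) * (x k)^-1))^-1.

(* mu is the R-algebra homomorphism with the prescribed values on the
   generators; it is determined by them (see [qtorus_ext]). *)
Definition is_quantum_mutation (D' : unitRingType)
    (iota' : {rmorphism qtorus_of qP (mutate k) -> D'})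
    (mu : {rmorphism D' -> D}) : Prop :=
  (forall c : R, mu (iota' c%:A) = iota c%:A) /\
  (forall i : idx s, mu (iota' (qX_of qP (mutate k) i)) = qmut i).

End QuantumMutation.

(* Main.v *)
Require Import Defs.
From HB Require Import structures.
From mathcomp Require Import all_boot all_order all_algebra.
From mathcomp Require Import finmap monalg zify ring.

Set Implicit Arguments.
Unset Strict Implicit.
Unset Printing Implicit Defensive.

Import Order.TTheory GRing.Theory Num.Theory.

Local Open Scope ring_scope.

(** Write [e_v] for the monomial basis of a quantum torus and [X = X_k] for the
    mutated variable.  The Frobenius map sends [e_v] to [e_{Nv}]; since
    [q ^ N = 1], every commutation factor of an [e_{Nv}] is trivial, which makes
    this a ring morphism with central values for any skew form.

    The content is the compatibility with mutations.  Put [t = q^{1/d_k}] and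
    let [Phi] be the solution of [Phi 0 = 1] and
    [Phi (j + 1) = Phi j * (1 + t^{2j+1} X)], for [j] in Z.  This is what remains
    at a root of unity of the quantum dilogarithm: moving it past an element that
    commutes with [X] up to a power of [t] only shifts [j] ([qdilog_shift]).  In
    these terms the cases of the mutation formula become one,
      [X'_i |-> e_{theta delta_i} Phi (- eps_ik)],
    with [theta] the linear involution of the exponent lattice that carries the
    form of the mutated seed to that of the seed ([qform_mut_exponent]).  So
    [e'_v |-> e_{theta v} Phi (- sum_i eps_ik v_i)] is multiplicative up to
    exactly the powers of [q] required ([mut_imageM]), and the mutation is a
    ring morphism from the mutated torus to the division ring.

    It extends to the fraction division ring because it is injective: once the
    finitely many [Phi]s that occur are brought to a common denominator, the
    image of [e'_v] is [e_{theta v}] plus terms of larger degree in [X], and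
    distinct leading monomials cannot cancel ([mutation_inj]); the extension of
    an injective morphism to fractions is the Ore argument of
    [fraction_extension].

    For [N]-th powers, [t ^ N = 1] gives [Phi (N m) = (Phi N) ^ m], and if [N]
    is odd, which coprimality ensures as soon as some [eps_ik] is nonzero, the
    powers of [t ^ 2] are all the [N]-th roots of unity, so that
    [Phi N = 1 + X ^ N].  Hence
      [(X'_i) ^ N |-> e_{N theta delta_i} (1 + X ^ N) ^ (- eps_ik)],
    which is the image under Frobenius of the classical mutation formula,
    written as [Y^{theta delta_i} (1 + Y_k) ^ (- eps_ik)] ([cmutE]). *)

(** * Fractions over a noncommutative ring *)

Lemma fraction_field_unit (A : nzRingType) (D : unitRingType)
    (iota : {rmorphism A -> D}) (a : A) :
  is_fraction_field iota -> a != 0 -> iota a \is a GRing.unit.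
Proof.
case=> inj unitD _ a0; apply: unitD.
by rewrite -(rmorph0 iota) (inj_eq inj).
Qed.

Lemma fraction_central (A : nzRingType) (D : unitRingType)
    (iota : {rmorphism A -> D}) (a : A) :
  is_fraction_field iota -> (forall b, a * b = b * a) ->
  forall x : D, iota a * x = x * iota a.
Proof.
move=> fr aC x; have [_ _ /(_ x)[b [c [c0 ->]]]] := fr.
have ab d : GRing.comm (iota a) (iota d) by rewrite /GRing.comm -!rmorphM aC.
by apply: commrM => //; apply: commrV.
Qed.

Section FractionExtension.
Variables (A : nzRingType) (D1 D2 : unitRingType).
Variables (iota : {rmorphism A -> D1}) (g : {rmorphism A -> D2}).
Hypothesis fr : is_fraction_field iota.
Hypothesis gU : forall a : A, a != 0 -> g a \is a GRing.unit.

Let iU (a : A) : a != 0 -> iota a \is a GRing.unit.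
Proof. exact: fraction_field_unit. Qed.

(** The right Ore condition, which holds because the left fraction
    [b^-1 d] is again a right fraction [e f^-1]. *)
Lemma right_common_multiple (b d : A) : b != 0 ->
  exists e f : A, f != 0 /\ d * f = b * e.
Proof.
move=> b0; have [inj _ frac] := fr.
have [e [f [f0 bd]]] := frac ((iota b)^-1 * iota d).
exists e, f; split=> //; apply: inj; rewrite !rmorphM.
by rewrite -[iota e](mulrVK (iU f0)) -bd -mulrA mulVKr ?iU.
Qed.

Lemma image_fraction_eq (a b c d : A) : b != 0 -> d != 0 ->
  iota a / iota b = iota c / iota d -> g a / g b = g c / g d.
Proof.
move=> b0 d0 abcd; have [e [f [f0 df]]] := right_common_multiple d b0.
have ae : a * e = c * f.
  have [inj _ _] := fr; apply: inj; rewrite !rmorphM.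
  rewrite -[iota a](mulrVK (iU b0)) abcd -!mulrA; congr (_ * _).
  by rewrite -rmorphM -df rmorphM mulKr ?iU.
have dfU : g (d * f) \is a GRing.unit by rewrite rmorphM unitrMl ?gU.
apply: (mulIr dfU); rewrite {1}df !rmorphM !mulrA !mulrVK ?gU //.
by rewrite -!rmorphM ae.
Qed.

(** The value on a fraction is forced, hence the only issue is that sums and
    products of fractions are computed through common right multiples, which
    any ring morphism respects. *)
Lemma fraction_extension :
  exists h : {rmorphism D1 -> D2}, forall a, h (iota a) = g a.
Proof.
have [inj unitD1 frac] := fr.
have repr x : exists p : A * A, (p.2 != 0) && (x == iota p.1 / iota p.2).
  by have [a [b [b0 ->]]] := frac x; exists (a, b); rewrite b0 eqxx.
pose p x := xchoose (repr x); pose h x := g (p x).1 / g (p x).2.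
have hE (a b : A) : b != 0 -> h (iota a / iota b) = g a / g b.
  move=> b0; have /andP[c0 /eqP px] := xchooseP (repr (iota a / iota b)).
  exact/esym/image_fraction_eq.
have prodU (b f : A) : b != 0 -> f != 0 -> b * f != 0.
  move=> b0 f0; apply/eqP => bf; have: iota b * iota f \is a GRing.unit.
    by rewrite unitrMl ?iU.
  by rewrite -rmorphM bf rmorph0 unitr0.
have fracM (D : unitRingType) (j : {rmorphism A -> D}) a b e :
    j b \is a GRing.unit -> j (b * e) \is a GRing.unit ->
    j a / j b = j (a * e) / j (b * e).
  move=> bU beU; apply: (mulIr beU); rewrite mulrVK //.
  by rewrite !rmorphM mulrA mulrVK.
have hB : zmod_morphism h.
  move=> x y; have [a [b [b0 ->]]] := frac x; have [c [d [d0 ->]]] := frac y.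
  have [e [f [f0 df]]] := right_common_multiple d b0.
  have df0 := prodU _ _ d0 f0; have be0 : b * e != 0 by rewrite -df.
  rewrite !hE // (fracM _ iota a b e) ?iU // (fracM _ iota c d f) ?iU //.
  rewrite (fracM _ g a b e) ?gU // (fracM _ g c d f) ?gU // df.
  by rewrite -!mulrBl -!rmorphB hE.
have hM : monoid_morphism h.
  split=> [|x y].
    by have := hE 1 1 (oner_neq0 _); rewrite !rmorph1 divr1 => ->; rewrite divr1.
  have [a [b [b0 ->]]] := frac x; have [c [d [d0 ->]]] := frac y.
  have [e [f [f0 cf]]] := right_common_multiple c b0.
  have key (D : unitRingType) (j : {rmorphism A -> D}) :
      (forall z : A, z != 0 -> j z \is a GRing.unit) ->
      j a / j b * (j c / j d) = j (a * e) / j (d * f).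
    move=> jU; have dfU : j (d * f) \is a GRing.unit by rewrite jU ?prodU.
    apply: (mulIr dfU); rewrite mulrVK // rmorphM !mulrA mulrVK ?jU //.
    by rewrite -!mulrA -rmorphM cf !rmorphM mulKr ?jU.
  rewrite !hE // (key _ iota) // (key _ g) // hE ?prodU //.
pose hAdd := GRing.isZmodMorphism.Build D1 D2 h hB.
pose hMul := GRing.isMonoidMorphism.Build D1 D2 h hM.
pose hR : {rmorphism D1 -> D2} := HB.pack h hAdd hMul.
exists hR => a.
by rewrite /= -[iota a]divr1 -(rmorph1 iota) hE ?oner_neq0 // rmorph1 divr1.
Qed.

End FractionExtension.

(** * Monomials in a quantum torus *)

Section MultiplesInForm.
Variables (I : finType) (L : I -> I -> int).
Implicit Types v w : {ffun I -> int}.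

Lemma qformMnr v w n : qform L v (w *+ n) = qform L v w * n%:Z.
Proof.
elim: n => [|n IH]; first by rewrite mulr0n qform0r mulr0.
by rewrite mulrS qformDr IH; lia.
Qed.

Lemma qformMnl v w n : qform L (v *+ n) w = qform L v w * n%:Z.
Proof.
elim: n => [|n IH]; first by rewrite mulr0n qform0l mulr0.
by rewrite mulrS qformDl IH; lia.
Qed.

End MultiplesInForm.

Section MonomialMorphism.
Variables (R : comUnitRingType) (q : R) (qU : q \is a GRing.unit).
Variables (I : finType) (L : I -> I -> int).
Local Notation T := (qtorus qU L).
Local Notation E := (qE qU L).
Implicit Types v w u : {ffun I -> int}.

(** Prescribing the image of every monomial, not only of the generators, asks
    for no inverses in [S], so that a quantum torus is an allowed target. *)
Lemma qtorus_morphism (S : nzRingType) (f : {rmorphism R -> S})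
    (h : {ffun I -> int} -> S) :
  (forall c y, f c * y = y * f c) -> h 0 = 1 ->
  (forall v w, h v * h w = f (q ^ qform L v w) * h (v + w)) ->
  {g : {rmorphism T -> S} |
    (forall c : R, g c%:A = f c) & forall v, g (E v) = h v}.
Proof.
move=> fC h0 hM; pose G := mmap f h : T -> S.
have GU c v : G (<< c *g v >> : {malg R[{ffun I -> int}]}) = f c * h v.
  by rewrite /G mmapU.
have GM : monoid_morphism G.
  split; first by rewrite (GU 1 0) h0 mulr1 rmorph1.
  move=> g1 g2; change (mmap f h (qmul q L g1 g2) = mmap f h g1 * mmap f h g2).
  rewrite /qmul raddf_sum [in RHS]mmapE mulr_suml; apply: eq_bigr => v _.
  rewrite raddf_sum [in RHS]mmapE mulr_sumr; apply: eq_bigr => w _.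
  rewrite /qterm /= mmapU /= !rmorphM -!mulrA -hM.
  by rewrite [in RHS](mulrA (h v)) -[h v * f _]fC !mulrA.
have GB : zmod_morphism G by move=> g1 g2; exact: (raddfB (mmap f h)).
pose GAdd := GRing.isZmodMorphism.Build T S G GB.
pose GMul := GRing.isMonoidMorphism.Build T S G GM.
pose g : {rmorphism T -> S} := HB.pack G GAdd GMul.
exists g => [c|v]; last by rewrite /= (GU 1) rmorph1 mul1r.
by rewrite /= -qE0 /qE qscaleU GU h0 !mulr1.
Qed.

Lemma qcoefE v w : (E v : {malg R[{ffun I -> int}]})@_w = (v == w)%:R.
Proof. by rewrite mcoeffU. Qed.

Lemma qcoefMr (a : T) u w :
  (a * E u : {malg R[{ffun I -> int}]})@_w =
    (a : {malg R[{ffun I -> int}]})@_(w - u) * q ^ qform L (w - u) u.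
Proof.
have fin (x : {malg R[{ffun I -> int}]}) v :
    x@_v = \sum_(j <- msupp x) x@_j *+ (j == v).
  by rewrite {1}(monalgE x) raddf_sum; apply: eq_bigr => j _; rewrite /= mcoeffU.
change ((qmul q L a << 1 *g u >>)@_w =
  (a : {malg R[{ffun I -> int}]})@_(w - u) * q ^ qform L (w - u) u).
rewrite qmulgU raddf_sum /= (fin a (w - u)) mulr_suml; apply: eq_bigr => j _.
rewrite mcoeffU mulr1.
have -> : (j + u == w) = (j == w - u) by rewrite [RHS]eq_sym subr_eq eq_sym.
by case: eqP => [->|_]; rewrite ?mulr0n ?mul0r.
Qed.

(** Among the leading monomials of least degree any one can only come from its
    own term: the tails of the others live in larger degrees. *)
Lemma leading_terms_free (deg : {ffun I -> int} -> int)
    (theta : {ffun I -> int} -> {ffun I -> int}) (u : {ffun I -> int} -> T)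
    (f : {malg R[{ffun I -> int}]}) :
  injective theta ->
  (forall v w, (u v - E (theta v) : {malg R[{ffun I -> int}]})@_w != 0 ->
     deg (theta v) < deg w) ->
  \sum_(v <- msupp f) f@_v *: u v = 0 -> f = 0.
Proof.
move=> thetaI lead sum0; apply/eqP/negPn/negP => f0.
have [supp0|[v1 v1f]] := fset_0Vmem (msupp f).
  by case/eqP: f0; apply/malgP => v; rewrite mcoeff0 mcoeff_outdom // supp0.
pose m0 : msupp f := [arg min_(v < [` v1f]%fset) deg (theta (val v))]%O.
have m0_min v : v \in msupp f -> deg (theta (val m0)) <= deg (theta v).
  rewrite /m0; case: Order.TotalTheory.arg_minP => // m _ mP vf.
  exact: (mP [` vf]%fset).
have coef v : v \in msupp f ->
    (u v : {malg R[{ffun I -> int}]})@_(theta (val m0)) = (v == val m0)%:R.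
  move=> vf; have <- := inj_eq thetaI; rewrite -qcoefE; apply/eqP.
  rewrite -subr_eq0 -mcoeffB; apply/negPn/negP => /lead.
  by rewrite ltNge m0_min.
have := congr1 (mcoeff (theta (val m0))) sum0; rewrite mcoeff0 raddf_sum /=.
rewrite (bigD1_seq (val m0)) ?fset_uniq //=; last exact: valP.
rewrite mcoeffZ coef ?(valP m0) // eqxx mulr1 big1_seq ?addr0 => [|v /andP[vm vf]].
  by apply/eqP; rewrite mcoeff_neq0 (valP m0).
by rewrite mcoeffZ coef // (negPf vm) mulr0.
Qed.

Lemma qdelta_neq0 (i : I) : qdelta i != 0.
Proof. by apply/eqP => /ffunP/(_ i)/eqP; rewrite !ffunE eqxx. Qed.

Lemma qEXn v n : (forall i j, L i j = - L j i) -> E v ^+ n = E (v *+ n).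
Proof.
move=> Lskew; elim: n => [|n IH]; first by rewrite mulr0n.
by rewrite exprS IH qEM qformMnr (qform_alt qU) // mul0r expr0z scale1r -mulrS.
Qed.

Lemma one_plus_monomial_neq0 (c : R) u : u != 0 -> 1 + c *: E u != 0 :> T.
Proof.
move=> /negPf u0; apply/eqP => /(congr1 (mcoeff (0 : {ffun I -> int}))).
rewrite mcoeff0 (mcoeffD 0 (E 0)) mcoeffZ !qcoefE eqxx u0 mulr0 addr0.
by apply/eqP/oner_neq0.
Qed.

Lemma leading_term_prod v u (deg : {ffun I -> int} -> int)
    (c : nat -> R) (j : nat) :
  (forall w, deg w = deg (w - u) + 1) -> forall w,
  (E v * \prod_(0 <= a < j) (1 + c a *: E u) - E v
     : {malg R[{ffun I -> int}]})@_w != 0 -> deg v < deg w.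
Proof.
move=> degS; elim: j => [|j IH] w.
  by rewrite big_geq // mulr1 subrr mcoeff0 eqxx.
rewrite big_nat_recr //= mulrA mulrDr mulr1 -scalerAr addrAC mcoeffD.
set p := (E v * _).
case: (eqVneq ((p - E v : {malg R[{ffun I -> int}]})@_w) 0); last first.
  by move=> pw _; exact: IH pw.
move=> ->; rewrite add0r mcoeffZ qcoefMr => pw.
have {pw} : (p : {malg R[{ffun I -> int}]})@_(w - u) != 0.
  by apply: contraNneq pw => ->; rewrite mul0r mulr0.
have := IH (w - u); rewrite mcoeffB qcoefE (degS w).
case: (eqVneq v (w - u)) => [-> _ _|_]; first by rewrite ltzD1.
by rewrite subr0 => lt /lt vw; apply: ltr_wpDr.
Qed.

End MonomialMorphism.

(** * The Frobenius map on a torus *)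

Section Frobenius.
Variables (R : idomainType) (N : nat) (q : R) (qP : N.-primitive_root q).
Variables (I : finType) (L : I -> I -> int).
Local Notation T := (qtorus (prim_unit qP) L).
Local Notation E := (qE (prim_unit qP) L).
Local Notation EY := (qE (unitr1 R) (@zero_form I)).

Lemma expz_root (z : R) (n : int) : z ^+ N = 1 -> z ^ (n * N%:Z) = 1.
Proof. by move=> zN; rewrite mulrC -exprz_exp -exprnP zN exp1rz. Qed.

Lemma frobenius_morphism : {F : {lrmorphism laurent R I -> T} |
  forall v, F (EY v) = E (v *+ N)}.
Proof.
have qN := prim_expr_order qP.
have aC (c : R) (y : T) : GRing.in_alg T c * y = y * GRing.in_alg T c.
  by rewrite /= mulr_algl mulr_algr.
have h0 : E (0 *+ N) = 1 by rewrite mul0rn.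
have hM v w : E (v *+ N) * E (w *+ N) =
    GRing.in_alg T (1 ^ qform (@zero_form I) v w) * E ((v + w) *+ N).
  rewrite exp1rz rmorph1 mul1r qEM qformMnr expz_root // scale1r.
  by rewrite mulrnDl.
have [F FA FE] := qtorus_morphism (unitr1 R) aC h0 hM.
have FZ : scalable F.
  by move=> c a; rewrite -mulr_algl rmorphM FA /= mulr_algl.
pose FLin := GRing.isScalable.Build R (laurent R I) T *:%R F FZ.
pose F' : {lrmorphism laurent R I -> T} :=
  HB.pack (F : _ -> _) (GRing.RMorphism.on F) FLin.
by exists F'.
Qed.

Variable F : {lrmorphism laurent R I -> T}.
Hypothesis FE : forall v, F (EY v) = E (v *+ N).

Lemma frobenius_expand (a : laurent R I) :
  F a = \sum_(v <- msupp (a : {malg R[{ffun I -> int}]}))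
    (a : {malg R[{ffun I -> int}]})@_v *: E (v *+ N).
Proof.
rewrite {1}(qtorus_sumE a) linear_sum; apply: eq_bigr => v _.
by rewrite linearZ /= FE.
Qed.

Lemma frobenius_central a b : F a * b = b * F a.
Proof.
rewrite frobenius_expand (qtorus_sumE b) mulr_suml mulr_sumr.
apply: eq_bigr => v _; rewrite [LHS]mulr_sumr [RHS]mulr_suml; apply: eq_bigr => w _.
have EC : E (v *+ N) * E w = E w * E (v *+ N).
  rewrite !qEM qformMnl qformMnr !expz_root ?(prim_expr_order qP) //.
  by rewrite !scale1r addrC.
rewrite -[LHS]scalerAl -scalerAr -[RHS]scalerAl -scalerAr EC !scalerA.
by rewrite [X in X *: _]mulrC.
Qed.

Lemma frobenius_inj a : F a = 0 -> a = 0.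
Proof.
rewrite frobenius_expand => Fa0.
apply: (leading_terms_free (L := L) (deg := fun=> 0)
  (theta := fun v => v *+ N) _ _ Fa0).
  move=> v w /ffunP vw; apply/ffunP => i; have := vw i; rewrite !ffunMnE.
  exact: pmulrnI (prim_order_gt0 qP) _ _.
by move=> v w; rewrite subrr mcoeff0 eqxx.
Qed.

End Frobenius.

(** * The quantum dilogarithm at a root of unity *)

Lemma int_ind_iff (P : int -> Prop) :
  P 0 -> (forall j, P j <-> P (j + 1)) -> forall j, P j.
Proof.
move=> P0 PS; elim/int_ind => // n Pn.
  by rewrite -addn1 PoszD; exact: (PS n%:Z).1 Pn.
by apply: (PS _).2; have -> : - n.+1%:Z + 1 = - n%:Z by lia.
Qed.

Section QuantumDilogarithm.
Variables (D : unitRingType) (t x : D).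

Definition qfactor (c : int) : D := 1 + t ^ (2 * c + 1) * x.

(** The solution on Z of [qdilog (j + 1) = qdilog j * qfactor j] with value 1 at
    0; for [t] generic it is the quotient of the quantum dilogarithms of
    [t ^ (2 j) * x] and [x]. *)
Definition qdilog (j : int) : D :=
  match j with
  | Posz n => \prod_(0 <= c < n) qfactor c%:Z
  | Negz n => (\prod_(0 <= c < n.+1) qfactor (- c.+1%:Z))^-1
  end.

Lemma qdilog0 : qdilog 0 = 1.
Proof. by rewrite /= big_geq. Qed.

Lemma qdilog_nat (m : nat) :
  \prod_(1 <= a < m.+1) (1 + t ^+ (2 * a - 1) * x) = qdilog m%:Z.
Proof.
rewrite big_add1; apply: eq_bigr => c _.
rewrite /qfactor -exprnP; congr (1 + t ^+ _ * x); lia.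
Qed.

Hypothesis tC : forall y, GRing.comm t y.
Hypothesis qfactorU : forall c, qfactor c \is a GRing.unit.

Lemma comm_tz n y : GRing.comm (t ^ n) y.
Proof. by apply/commr_sym/commrXz/commr_sym/tC. Qed.

Lemma qfactor_comm c y : GRing.comm x y -> GRing.comm (qfactor c) y.
Proof.
move=> xy; apply/commr_sym/commrD; first exact: commr1.
by apply/commrM; apply/commr_sym => //; exact: comm_tz.
Qed.

Lemma qdilog_comm j y : GRing.comm x y -> GRing.comm (qdilog j) y.
Proof.
move=> xy; apply/commr_sym; case: j => n /=; last apply: commrV.
  all: by apply: commr_prod => c _; apply/commr_sym/qfactor_comm.
Qed.

Lemma qdilog_unit j : qdilog j \is a GRing.unit.
Proof. by case: j => n /=; rewrite ?unitrV rpred_prod. Qed.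

Lemma qdilogS j : qdilog (j + 1) = qdilog j * qfactor j.
Proof.
have facC a b : GRing.comm (qfactor a) (qfactor b).
  by apply/qfactor_comm/commr_sym/qfactor_comm.
case: j => [n|[|n]]; first by rewrite -PoszD addn1 /= big_nat_recr.
  by rewrite /= big_geq // big_nat1 mulVr.
have -> : Negz n.+1 + 1 = Negz n by lia.
rewrite /= [in RHS]big_nat_recr //= invrM ?rpred_prod // -mulrA.
have PC : GRing.comm (\prod_(0 <= c < n.+1) qfactor (Negz c))^-1
    (qfactor (Negz n.+1)).
  by apply/commr_sym/commrV/commr_prod.
by rewrite PC mulKr.
Qed.

Hypothesis tU : t \is a GRing.unit.

(** Moving [y] to the left turns [x] into [t ^ (- 2 * n) * x], hence [qfactor c]
    into [qfactor (c - n)]: both sides solve the same difference equation in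
    [j], and agree at 0. *)
Lemma qdilog_shift n y : x * y = t ^ (- 2 * n) * (y * x) ->
  forall j, qdilog j * y = y * (qdilog (j - n) / qdilog (- n)).
Proof.
move=> xy; have fac_y c : qfactor c * y = y * qfactor (c - n).
  rewrite mulrDl mulrDr mul1r mulr1 -mulrA xy !mulrA -exprzDr //.
  rewrite -(comm_tz _ y); congr (_ + t ^ _ * _ * _); lia.
have SC j c : qdilog j * qfactor c = qfactor c * qdilog j.
  by apply/qdilog_comm/commr_sym/qfactor_comm.
apply: int_ind_iff => [|j].
  by rewrite qdilog0 sub0r divrr ?qdilog_unit ?mul1r ?mulr1.
have -> : j + 1 - n = j - n + 1 by lia.
rewrite !qdilogS !SC -(mulrA (qfactor j)) -(mulrA (qfactor (j - n))).
rewrite (mulrA y (qfactor _)) -fac_y -(mulrA (qfactor j)).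
by split=> [->|/(mulrI (qfactorU j))].
Qed.

(** The factors are [n]-periodic, so that [qdilog (j + n) = qdilog j * qdilog n]. *)
Lemma qdilog_periodic (n : int) : t ^ n = 1 ->
  forall m, qdilog (n * m) = qdilog n ^ m.
Proof.
move=> tn; have facD j : qfactor (j + n) = qfactor j.
  rewrite /qfactor; congr (1 + _ * x).
  have -> : 2 * (j + n) + 1 = 2 * j + 1 + n + n by lia.
  by rewrite !(exprzDr tU _ n) tn !mulr1.
have SC j : qdilog n * qfactor j = qfactor j * qdilog n.
  by apply/qdilog_comm/commr_sym/qfactor_comm.
have qdilogD : forall j, qdilog (j + n) = qdilog j * qdilog n.
  apply: int_ind_iff => [|j]; first by rewrite add0r qdilog0 mul1r.
  have -> : j + 1 + n = j + n + 1 by lia.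
  rewrite !qdilogS facD -mulrA -SC.
  by rewrite mulrA; split=> [->|/(mulIr (qfactorU j))].
apply: int_ind_iff => [|m]; first by rewrite mulr0 qdilog0 expr0z.
rewrite mulrDr mulr1 qdilogD exprzDr ?qdilog_unit // expr1z.
by split=> [->|/(mulIr (qdilog_unit n))].
Qed.

Hypothesis xU : x \is a GRing.unit.

(** Each [1 + u * x^-1] is the monomial [u * x^-1] times [1 + u^-1 * x], and the
    exponents [1, 3, ..., 2 m - 1] of [t] add up to [m ^ 2].  This absorbs the
    branch of the mutation formula with inverse powers of [x]. *)
Lemma qdilog_opp (m : nat) :
  \prod_(1 <= a < m.+1) (1 + t ^+ (2 * a - 1) * x^-1) =
    (t ^ (- (m ^ 2)%N%:Z) * x ^+ m * qdilog (- m%:Z))^-1.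
Proof.
have ZU n : t ^ (- (n ^ 2)%N%:Z) * x ^+ n * qdilog (- n%:Z) \is a GRing.unit.
  by rewrite !unitrMl ?unitrXz ?unitrX ?qdilog_unit.
rewrite big_add1; elim: m => [|m IH].
  by rewrite big_geq // qdilog0 expr0z !mulr1 invr1.
rewrite big_nat_recr //= IH; apply: (mulIr (ZU m.+1)).
rewrite mulVr // -mulrA -[RHS](mulVr (ZU m)); congr (_ * _).
have -> : - m%:Z = - m.+1%:Z + 1 by lia.
rewrite qdilogS /qfactor mulrDl mul1r !mulrDr mulr1 addrC; congr (_ + _).
  rewrite exprnP !mulrA -(mulrA _ x^-1 (t ^ _)) -(comm_tz _ x^-1) exprS.
  rewrite !mulrA mulrVK // -exprzDr //; congr (t ^ _ * _ * _); lia.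
have -> : qdilog (- m.+1%:Z) * (t ^ (2 * - m.+1%:Z + 1) * x) =
    t ^ (2 * - m.+1%:Z + 1) * (x * qdilog (- m.+1%:Z)).
  by rewrite mulrA -comm_tz -mulrA (qdilog_comm _ (erefl _)).
rewrite mulrA -(mulrA _ (x ^+ m)) -(comm_tz _ (x ^+ m)) exprSr !mulrA.
rewrite -exprzDr //; congr (t ^ _ * _ * _ * _); lia.
Qed.

End QuantumDilogarithm.

Lemma prod_unity_roots (R : idomainType) (N : nat) (z : R) :
  N.-primitive_root z -> \prod_(0 <= i < N) ('X - (z ^+ i)%:P) = 'X^N - 1.
Proof.
move=> zP; apply: (map_inj_poly (f := @tofrac R)); rewrite ?rmorph0 //.
  by move=> a b /eqP; rewrite tofrac_eq => /eqP.
rewrite rmorph_prod rmorphB rmorph1 /= map_polyXn.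
rewrite -(factor_Xn_sub_1 (prim_root_tofrac zP)); apply: eq_bigr => i _.
by rewrite rmorphB /= map_polyX map_polyC /= rmorphXn.
Qed.

(** As [N] is odd, [z ^ 2] is primitive too, and the product is that of the
    ['X - w], for all roots of unity [w], evaluated at [b^-1] and multiplied by
    [b ^ N], where [b = - f z * x]. *)
Lemma qdilog_root (R : idomainType) (D : unitRingType) (f : {rmorphism R -> D})
    (N : nat) (z : R) (x : D) :
  (forall c y, GRing.comm (f c) y) -> N.-primitive_root z -> odd N ->
  x \is a GRing.unit -> qdilog (f z) x N%:Z = 1 + x ^+ N.
Proof.
move=> fC zP Nodd xU; have zU := prim_unit zP.
have z2P : N.-primitive_root (z ^+ 2).
  by rewrite prim_root_exp_coprime // coprime2n.
have tU : f z \is a GRing.unit by rewrite rmorph_unit.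
pose b := - (f z * x); have bU : b \is a GRing.unit by rewrite unitrN unitrMl.
have fbC : commr_rmorph f b^-1 by move=> c; apply/commr_sym/fC.
have factorE c : b * (b^-1 - f ((z ^+ 2) ^+ c)) = qfactor (f z) x c%:Z.
  rewrite mulrBr divrr // mulNr opprK -mulrA -fC mulrA -rmorphM -exprM -exprS.
  have -> : qfactor (f z) x c%:Z = 1 + f z ^ (2 * c).+1%:Z * x.
    by congr (1 + _ ^ _ * _); lia.
  by rewrite -exprnP rmorphXn.
have bC c : GRing.comm b (b^-1 - f ((z ^+ 2) ^+ c)).
  by apply: commrB; [exact: commrV | exact/commr_sym/fC].
have prodE n : qdilog (f z) x n%:Z =
    b ^+ n * \prod_(0 <= c < n) (b^-1 - f ((z ^+ 2) ^+ c)).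
  elim: n => [|n IH]; first by rewrite qdilog0 big_geq // mulr1.
  rewrite /= !big_nat_recr //= -[X in X * _]/(qdilog (f z) x n%:Z) IH -factorE.
  rewrite (exprSr b) -!mulrA; congr (_ * _); rewrite !mulrA; congr (_ * _).
  by apply/commr_sym/commr_prod => c _; exact: bC.
have := congr1 (horner_morph fbC) (prod_unity_roots z2P).
rewrite rmorph_prod rmorphB rmorphXn rmorph1 /= horner_morphX => prodN.
rewrite -[LHS]/(qdilog (f z) x N%:Z) prodE.
under eq_bigr => c _ do
  rewrite -(horner_morphC fbC) -[X in X - _](horner_morphX fbC) -rmorphB.
rewrite prodN mulrBr mulr1 -exprMn_comm ?divrr ?expr1n //; last exact: commrV.
rewrite exprNn -signr_odd Nodd expr1 mulN1r opprK exprMn_comm; last exact: fC.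
by rewrite -rmorphXn (prim_expr_order zP) rmorph1 mul1r.
Qed.

(** * The monomial part of a mutation *)

Section MonomialPart.
Variables (s : seed) (k : idx s).
Local Notation K := {ffun idx s -> int}.

Definition mut_shift (i : idx s) : int :=
  (if 0 <= eps s i k then eps s i k else 0) - 2 * (i == k)%:Z.

(** The tropical part of the mutation, as a linear map on exponents: it sends
    [delta_k] to [- delta_k] and [delta_i] to [delta_i + max(0, eps_ik) delta_k]
    for the other [i]. *)
Definition mut_exponent (v : K) : K :=
  v + qdelta k *~ (\sum_i mut_shift i * v i).

Definition slope (v : K) : int := \sum_i eps s i k * v i.

Lemma epsh_diag i : epsh s i i = 0.
Proof. by have := epsh_skew i i; lia. Qed.

Lemma eps_diag i : eps s i i = 0.
Proof. by rewrite epsE epsh_diag mul0r. Qed.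

(** The piecewise mutation rule is one change of basis: away from [k], [epsh_ik]
    and [epsh_jk] produce the correction
    [max(0, eps_jk) epsh_ik - max(0, eps_ik) epsh_jk], which vanishes
    unless they have opposite signs. *)
Lemma epsh_mutate (i j : idx s) : epsh (mutate k) i j =
  epsh s i j + mut_shift j * epsh s i k - mut_shift i * epsh s j k.
Proof.
have d_gt0 l : (0 : int) < (mult s l)%:Z by rewrite ltz_nat mult_gt0.
have d_neq0 l : (mult s l)%:Z != 0 by rewrite gt_eqF.
rewrite {1}/epsh /= /mut_eps /mut_shift.
case: (eqVneq i k) => [->|ik] /=.
  rewrite (epsE k j) -mulNr mulzK // eps_diag epsh_diag (epsh_skew j k) lexx; ring.
case: (eqVneq j k) => [->|jk] /=.
  rewrite (epsE i k) -mulNr mulzK // eps_diag epsh_diag lexx; ring.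
rewrite (epsE i k) (epsE j k) (epsE k j) (epsE i j) (epsh_skew k j).
have := d_gt0 k; have := d_gt0 j.
move: (epsh s i k) (epsh s j k) (epsh s i j) (d_neq0 j) => a b c dj0.
case: ifP => cond dj dk.
  rewrite mulzK //; case: ifP; case: ifP; nia.
rewrite mulrA -mulrDl mulzK //; case: ifP; case: ifP; nia.
Qed.

Lemma mut_shift_delta (i : idx s) :
  \sum_j mut_shift j * (qdelta i) j = mut_shift i.
Proof.
rewrite (bigD1 i) //= ffunE eqxx mulr1 big1 ?addr0 // => j /negPf ji.
by rewrite ffunE ji mulr0.
Qed.

Lemma slope_delta (i : idx s) : slope (qdelta i) = eps s i k.
Proof.
rewrite /slope (bigD1 i) //= ffunE eqxx mulr1 big1 ?addr0 // => j /negPf ji.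
by rewrite ffunE ji mulr0.
Qed.

Lemma slopeD v w : slope (v + w) = slope v + slope w.
Proof. by rewrite -big_split /=; apply: eq_bigr => i _; rewrite ffunE mulrDr. Qed.

Lemma slopeMz v n : slope (v *~ n) = slope v * n.
Proof.
by rewrite mulr_suml; apply: eq_bigr => i _; rewrite ffunMzE mulrzz mulrA.
Qed.

Lemma qform_deltar v : qform (epsh s) v (qdelta k) = \sum_i epsh s i k * v i.
Proof.
apply: eq_bigr => i _.
rewrite (bigD1 k) //= ffunE eqxx mulr1 big1 ?addr0 // => j /negPf jk.
by rewrite ffunE jk mulr0.
Qed.

Lemma qform_skew v w : qform (epsh s) v w = - qform (epsh s) w v.
Proof.
rewrite /qform exchange_big -sumrN; apply: eq_bigr => i _.
by rewrite -sumrN; apply: eq_bigr => j _; rewrite epsh_skew; ring.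
Qed.

Lemma slopeE v : slope v = qform (epsh s) v (qdelta k) * (mult s k)%:Z.
Proof.
rewrite qform_deltar mulr_suml; apply: eq_bigr => i _.
by rewrite epsE mulrAC.
Qed.

Lemma mut_exponentD v w : mut_exponent (v + w) = mut_exponent v + mut_exponent w.
Proof.
rewrite /mut_exponent addrACA -mulrzDr -big_split /=; congr (_ + _ *~ _).
by apply: eq_bigr => i _; rewrite ffunE mulrDr.
Qed.

Lemma mut_exponentMn v n : mut_exponent (v *+ n) = mut_exponent v *+ n.
Proof.
elim: n => [|n IH]; last by rewrite !mulrS mut_exponentD IH.
rewrite !mulr0n /mut_exponent add0r big1 ?mulr0z // => i _.
by rewrite ffunE mulr0.
Qed.

Lemma slope_mut_exponent v : slope (mut_exponent v) = slope v.
Proof. by rewrite slopeD slopeMz slope_delta eps_diag mul0r addr0. Qed.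

Lemma mut_exponentK : involutive mut_exponent.
Proof.
move=> v; rewrite {1}/mut_exponent.
suff -> : \sum_i mut_shift i * mut_exponent v i = - \sum_i mut_shift i * v i.
  by rewrite mulrNz /mut_exponent addrK.
rewrite /mut_exponent; set n := (X in _ *~ X); rewrite -/n.
transitivity (n + mut_shift k * n); last first.
  by rewrite /mut_shift eps_diag lexx eqxx; lia.
rewrite -(mut_shift_delta k) mulr_suml -big_split /=; apply: eq_bigr => i _.
by rewrite ffunE ffunMzE mulrzz mulrDr mulrA.
Qed.

Lemma qform_mut_exponent v w :
  qform (epsh s) (mut_exponent v) (mut_exponent w) =
    qform (epsh (mutate k)) v w.
Proof.
have qformMz u1 u2 n : qform (epsh s) u1 (u2 *~ n) = qform (epsh s) u1 u2 * n.
  rewrite mulr_suml; apply: eq_bigr => i _; rewrite mulr_suml.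
  by apply: eq_bigr => j _; rewrite ffunMzE mulrzz mulrA.
have qkk : qform (epsh s) (qdelta k) (qdelta k) = 0.
  by rewrite qform_delta epsh_diag.
rewrite qformDl (qform_skew (_ *~ _)) !qformDr !qformMz.
rewrite qformDl (qform_skew (_ *~ _)) qformMz qkk mul0r oppr0 addr0.
rewrite !qform_deltar !big_distrlr /= [X in _ - X]exchange_big /=.
rewrite /qform -sumrN -!big_split /=; apply: eq_bigr => i _.
rewrite -sumrN -!big_split /=; apply: eq_bigr => j _.
rewrite epsh_mutate; ring.
Qed.

End MonomialPart.

(** * The quantum mutation as a morphism to fractions *)

Section MutationMorphism.
Variables (R : idomainType) (N : nat) (q : R) (qP : N.-primitive_root q).
Variables (s : seed) (k : idx s).
Hypothesis qdP : N.-primitive_root (q ^+ mult s k).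
Variables (D : unitRingType) (iD : {rmorphism qtorus_of qP s -> D}).
Hypothesis fr : is_fraction_field iD.
Local Notation K := {ffun idx s -> int}.
Local Notation T := (qtorus_of qP s).
Local Notation T' := (qtorus_of qP (mutate k)).
Local Notation E v := (qE (prim_unit qP) (epsh s) v : T).

Let z : R := qroot N q (mult s k).
Let f : {rmorphism R -> D} := (iD \o GRing.in_alg T)%FUN.
Let t : D := f z.
Let x : D := iD (E (qdelta k)).
Local Notation Phi := (qdilog t x).

Lemma scalar_image c (y : T) : iD (c *: y) = f c * iD y.
Proof. by rewrite -mulr_algl rmorphM. Qed.

Lemma scalar_central c (y : D) : GRing.comm (f c) y.
Proof.
by apply: (fraction_central (iota := iD)) => // b; rewrite /= mulr_algl mulr_algr.
Qed.

(** The order of [z] divides [N], and is a multiple of the order [N] of its power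
    [q = z ^ mult s k]. *)
Lemma qroot_prim : N.-primitive_root z.
Proof.
have [zN zd _] := qrootP qP qdP.
have zP : (0 < N)%N by exact: prim_order_gt0 qP.
have [n nP nN] := prim_order_exists zP zN.
suff -> : N = n by [].
apply/eqP; rewrite eqn_dvd nN (prim_order_dvd qP) -[in q ^+ n]zd exprAC.
by rewrite (prim_expr_order nP) expr1n eqxx.
Qed.

Lemma qroot_unit : z \is a GRing.unit. Proof. exact: prim_unit qroot_prim. Qed.

Lemma image_qroot_unit : t \is a GRing.unit.
Proof. by rewrite rmorph_unit ?qroot_unit. Qed.

Lemma image_q n : f (q ^ n) = t ^ ((mult s k)%:Z * n).
Proof.
have [_ zd _] := qrootP qP qdP.
by rewrite -exprz_exp -exprnP -rmorphXn zd rmorphXz ?(prim_unit qP).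
Qed.

Lemma imageM v w : iD (E v) * iD (E w) =
  t ^ ((mult s k)%:Z * qform (epsh s) v w) * iD (E (v + w)).
Proof. by rewrite -rmorphM qEM scalar_image image_q. Qed.

Lemma image_unit v : iD (E v) \is a GRing.unit.
Proof.
apply: fraction_field_unit fr _; apply/eqP => /(congr1 (mcoeff v)).
by rewrite qcoefE mcoeff0 eqxx => /eqP; rewrite oner_eq0.
Qed.

Lemma qfactorE c : qfactor t x c = iD (1 + z ^ (2 * c + 1) *: E (qdelta k)).
Proof. by rewrite rmorphD rmorph1 scalar_image rmorphXz ?qroot_unit. Qed.

Lemma qfactor_unit c : qfactor t x c \is a GRing.unit.
Proof.
rewrite qfactorE; apply: fraction_field_unit fr _.
exact/one_plus_monomial_neq0/qdelta_neq0.
Qed.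

Let tC y : GRing.comm t y. Proof. exact: scalar_central. Qed.

Lemma twist w : x * iD (E w) = t ^ (- 2 * slope k w) * (iD (E w) * x).
Proof.
rewrite !imageM mulrA -exprzDr ?image_qroot_unit // addrC; congr (t ^ _ * iD (E _)).
by rewrite slopeE qform_skew; ring.
Qed.

(** The value of the mutation on every monomial of the mutated torus; on the
    generators it is the prescribed one by [mut_image_delta]. *)
Definition mut_image (v : K) : D := iD (E (mut_exponent k v)) * Phi (- slope k v).

(** Moving [qdilog] across the second monomial cancels the second [qdilog] by
    [qdilog_shift]; this is the consistency of the mutation formulas with the
    commutation relations. *)
Lemma mut_imageM v w : mut_image v * mut_image w =
  f (q ^ qform (epsh (mutate k)) v w) * mut_image (v + w).
Proof.
have := qdilog_shift tC qfactor_unit image_qroot_unit (twist (mut_exponent k w)).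
rewrite slope_mut_exponent => /(_ (- slope k v)) shift.
rewrite /mut_image -mulrA (mulrA (Phi _)) shift -!mulrA.
rewrite mulVr ?qdilog_unit //; last first.
  exact: qfactor_unit.
rewrite mulr1 mulrA imageM -image_q qform_mut_exponent -mut_exponentD.
by rewrite slopeD opprD -mulrA.
Qed.

Lemma mut_image0 : mut_image 0 = 1.
Proof.
rewrite /mut_image -(mulr0n 0) mut_exponentMn !mulr0n.
have -> : slope k 0 = 0 by rewrite /slope big1 // => i _; rewrite ffunE mulr0.
by rewrite oppr0 qdilog0 mulr1 rmorph1.
Qed.

Lemma mut_image_delta i : mut_image (qdelta i) = qmut k iD i.
Proof.
have qdU := qdilog_unit qfactor_unit.
rewrite /mut_image slope_delta /mut_exponent mut_shift_delta /qmut /mut_shift.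
rewrite -[iD (qroot _ _ _)%:A]/t -[iD (qX_of qP s k)]/x.
have xU : x \is a GRing.unit := image_unit _.
case: (eqVneq i k) => [->|ik] /=.
  rewrite eps_diag lexx sub0r oppr0 qdilog0 mulr1.
  apply: (mulrI xU); rewrite divrr // -rmorphM -(rmorph1 iD).
  have [<- _] := qEV (prim_unit qP) (@epsh_skew s) (qdelta k).
  congr (iD (_ * E _)); rewrite mulr1 mulrNz -[2]/(2%N%:Z) -pmulrn mulr2n.
  by rewrite opprD addrA subrr add0r.
rewrite mulr0 subr0; have [le0|gt0] := lerP (eps s i k) 0.
  have -> : (if 0 <= eps s i k then eps s i k else 0) = 0 by case: ifP; lia.
  by rewrite mulr0z addr0 qdilog_nat; congr (_ * qdilog _ _ _); lia.
rewrite ltW //; have [n mn] : exists n : nat, eps s i k = n%:Z.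
  by exists `|eps s i k|%N; lia.
rewrite mn absz_nat (qdilog_opp tC qfactor_unit image_qroot_unit xU) invrK.
rewrite !mulrA; congr (_ * _).
rewrite -[iD (qX_of qP s i)]/(iD (E (qdelta i))) -(comm_tz tC) -mulrA.
rewrite -rmorphXn qEXn; last exact: epsh_skew.
rewrite imageM qformMnr qform_delta mulrA -exprzDr ?image_qroot_unit //.
have -> : (mult s k)%:Z * (epsh s i k * n%:Z) = (n ^ 2)%N%:Z.
  by rewrite mulrA [_ * epsh s i k]mulrC -epsE mn; lia.
by rewrite addNr expr0z mul1r -pmulrn.
Qed.

(** The [qdilog] at a multiple of [N] is a power of [qdilog N = 1 + X_k ^ N]; the
    parity of [N] is asked where the exponent is nonzero because this is where
    coprimality with the exchange coefficients yields it. *)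
Lemma mut_image_frobenius v : (slope k v != 0 -> odd N) -> mut_image (v *+ N) =
  iD (E (mut_exponent k v *+ N)) *
    (1 + iD (E (qdelta k *+ N))) ^ (- slope k v).
Proof.
move=> Nodd; rewrite /mut_image mut_exponentMn (pmulrn v) slopeMz; congr (_ * _).
have [->|/Nodd {}Nodd] := eqVneq (slope k v) 0.
  by rewrite mul0r oppr0 qdilog0 expr0z.
have tN : t ^ N%:Z = 1.
  by rewrite -exprnP -rmorphXn (prim_expr_order qroot_prim) rmorph1.
rewrite -mulNr mulrC (qdilog_periodic tC qfactor_unit image_qroot_unit tN).
have -> := qdilog_root scalar_central qroot_prim Nodd (image_unit (qdelta k)).
by rewrite -rmorphXn qEXn //; exact: epsh_skew.
Qed.

Lemma mutation_morphism : {g : {rmorphism T' -> D} |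
  (forall c : R, g c%:A = iD c%:A)
  & forall v, g (qE (prim_unit qP) (epsh (mutate k)) v) = mut_image v}.
Proof.
have [g gA gE] := qtorus_morphism (prim_unit qP) (L := epsh (mutate k))
  scalar_central mut_image0 mut_imageM.
by exists g.
Qed.

(** For [M >= slope k v], what remains of [mut_image v] after division by the
    common denominator [Phi (- M)]: the product of the factors by which
    [Phi (- slope k v)] and [Phi (- M)] differ. *)
Definition cleared_image (M : int) (v : K) : T :=
  E (mut_exponent k v) * \prod_(0 <= a < `|M - slope k v|)
    (1 + z ^ (2 * (a%:Z - M) + 1) *: E (qdelta k)).

Lemma mut_image_cleared M v : slope k v <= M ->
  mut_image v / Phi (- M) = iD (cleared_image M v).
Proof.
move=> vM; have PhiE n : Phi (n%:Z - M) =
    iD (\prod_(0 <= a < n) (1 + z ^ (2 * (a%:Z - M) + 1) *: E (qdelta k)))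
      * Phi (- M).
  elim: n => [|n IH]; first by rewrite sub0r big_geq // rmorph1 mul1r.
  have -> : n.+1%:Z - M = n%:Z - M + 1 by lia.
  rewrite (qdilogS tC qfactor_unit) IH big_nat_recr //= rmorphM -qfactorE.
  rewrite -!mulrA; congr (_ * _).
  by apply/(qdilog_comm tC)/commr_sym/(qfactor_comm tC).
rewrite /mut_image.
have -> : - slope k v = `|M - slope k v|%N%:Z - M by lia.
rewrite PhiE rmorphM -!mulrA divrr ?mulr1 //.
by apply: qdilog_unit; exact: qfactor_unit.
Qed.

Lemma mutation_inj (g : {rmorphism T' -> D}) :
  (forall c : R, g c%:A = iD c%:A) ->
  (forall v, g (qE (prim_unit qP) (epsh (mutate k)) v) = mut_image v) ->
  forall a : T', a != 0 -> g a \is a GRing.unit.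
Proof.
move=> gA gE a; have [iI unitD _] := fr => a0; apply: unitD.
apply: contraNneq a0 => ga0.
pose a' : {malg R[K]} := a.
(* Large enough for every [qdilog] in [g a] to be a polynomial multiple of
   [qdilog (- M)]. *)
pose M : int := (\sum_(v <- msupp a') `|slope k v|)%N%:Z.
have leM v : v \in msupp a' -> slope k v <= M.
  move=> va; apply: le_trans (ler_norm _) _.
  by rewrite -abszE lez_nat /M (bigD1_seq v) ?fset_uniq //= leq_addr.
suff : a' = 0 by move=> a'0; apply/eqP.
apply: (leading_terms_free (deg := fun w : K => w k) (u := cleared_image M)).
- exact: inv_inj (mut_exponentK k).
- move=> v w; apply: (leading_term_prod (deg := fun w : K => w k)) => {}w.
  by rewrite !ffunE eqxx subrK.
apply: iI; rewrite rmorph0 rmorph_sum /=.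
transitivity (g a / Phi (- M)); last by rewrite ga0 mul0r.
rewrite [in RHS](qtorus_sumE a) rmorph_sum mulr_suml.
rewrite [LHS]big_seq [RHS]big_seq; apply: eq_bigr => v va.
rewrite scalar_image -mut_image_cleared ?leM // mulrA -gE; congr (_ * _).
by rewrite -mulr_algl rmorphM gA.
Qed.

End MutationMorphism.

(** * Classical mutations and the main theorem *)

Lemma seed_equiv_prim (R : idomainType) (N : nat) (q : R) (s0 s : seed) :
  (forall k : idx s0, N.-primitive_root (q ^+ mult s0 k)) -> seed_equiv s0 s ->
  forall k : idx s, N.-primitive_root (q ^+ mult s k).
Proof.
move=> qdP; elim=> {s} // t u g _ tP [[h hK gK] _ _ gm] k.
by rewrite -(gK k) gm.
Qed.

Lemma odd_of_coprimez (e : int) (N : nat) : coprimez (2 * e) N%:Z -> odd N.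
Proof.
rewrite coprimezMl => /andP[]; rewrite /coprimez /gcdz /= => /eqP[g1] _.
by rewrite -coprime2n /coprime g1.
Qed.

Section ClassicalMutation.
Variables (R : idomainType) (s : seed) (k : idx s).
Variables (K : fieldType) (iK : {rmorphism laurent R (idx s) -> K}).
Hypothesis iK_inj : injective iK.
Local Notation EY := (qE (unitr1 R) (@zero_form (idx s))).

Lemma laurentD v w : EY v * EY w = EY (v + w).
Proof. by rewrite qEM exp1rz scale1r. Qed.

Lemma image_laurent_neq0 v : iK (EY v) != 0.
Proof.
rewrite -(rmorph0 iK) (inj_eq iK_inj); apply/eqP => /(congr1 (mcoeff v)).
by rewrite qcoefE mcoeff0 eqxx => /eqP; rewrite oner_eq0.
Qed.

Lemma image_laurentMz v n : iK (EY (v *~ n)) = iK (EY v) ^ n.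
Proof.
elim/int_ind_iff: n => [|n]; first by rewrite mulr0z rmorph1 expr0z.
rewrite mulrzDr mulr1z -laurentD rmorphM exprzDr ?unitfE ?image_laurent_neq0 //.
by rewrite expr1z; split=> [->|/(mulIf (image_laurent_neq0 _))].
Qed.

(** Since [1 + Y_k^-1 = Y_k^-1 (1 + Y_k)], the classical formula has the same
    single shape, with the same monomial part, as the quantum one. *)
Lemma cmutE i : cmut k iK i =
  iK (EY (mut_exponent k (qdelta i))) * (1 + iK (lY R k)) ^ (- eps s i k).
Proof.
rewrite /mut_exponent mut_shift_delta -laurentD rmorphM image_laurentMz.
rewrite /cmut /mut_shift.
rewrite -![iK (EY (qdelta _))]/(iK (lY R _)).
have y0 : iK (lY R k) != 0 := image_laurent_neq0 _.
case: (eqVneq i k) => [->|ik].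
  rewrite eps_diag lexx oppr0 expr0z mulr1 sub0r mulr1.
  by rewrite -[X in X * _]expr1z -expfzDr.
rewrite mulr0 subr0 -mulrA; congr (_ * _).
case: (ltrgtP (eps s i k) 0) => [m0|m0|->]; last by rewrite oppr0 !expr0z mulr1.
  by rewrite ltr0_sgz // opprK expr1z expr0z mul1r.
rewrite gtr0_sgz // -[RHS]mulrC.
have -> : 1 + iK (lY R k) ^ (- 1) = iK (lY R k) ^ (- 1) * (1 + iK (lY R k)).
  by rewrite mulrDr mulr1 exprN1 mulVf // addrC.
by rewrite expfzMl exprz_exp mulN1r opprK mulrC.
Qed.

End ClassicalMutation.

Theorem theorem3p11 (R : idomainType) (N : nat) (q : R)
    (qP : N.-primitive_root q) (s0 : seed)
    (qdP : forall k : idx s0, N.-primitive_root (q ^+ mult s0 k))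
    (epsP : forall s : seed, seed_equiv s0 s ->
       forall i j : idx s, eps s i j != 0 -> coprimez (2 * eps s i j) N%:Z) :
  exists F : forall s : seed, {lrmorphism laurent R (idx s) -> qtorus_of qP s},
    forall s : seed, seed_equiv s0 s ->
    [/\ forall i : idx s, F s (lY R i) = qX_of qP s i ^+ N,
        forall f g, F s f * g = g * F s f
      & forall (K : fieldType) (iK : {rmorphism laurent R (idx s) -> K})
               (D : unitRingType) (iD : {rmorphism qtorus_of qP s -> D}),
        is_fraction_field iK -> is_fraction_field iD ->
        exists Fr : {rmorphism K -> D},
          (forall f, Fr (iK f) = iD (F s f)) /\
          forall k : idx s, k \notin frozen s ->
          forall (D' : unitRingType)
                 (iD' : {rmorphism qtorus_of qP (mutate k) -> D'}),
          is_fraction_field iD' ->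
          (exists mu : {rmorphism D' -> D}, is_quantum_mutation iD iD' mu) /\
          (forall mu : {rmorphism D' -> D}, is_quantum_mutation iD iD' mu ->
             forall i : idx s,
               mu (iD' (qX_of qP (mutate k) i ^+ N)) = Fr (cmut k iK i))].
Proof.
exists (fun s => sval (frobenius_morphism qP (epsh s))) => s s0s.
case: (frobenius_morphism _ _) => F FE /=.
split=> [i|f g|K iK D iD frK frD].
- by rewrite FE qEXn //; exact: epsh_skew.
- exact: frobenius_central.
have [iK_inj _ _] := frK.
pose iDF : {rmorphism laurent R (idx s) -> D} := (iD \o F)%FUN.
have iDF_unit a : a != 0 -> iDF a \is a GRing.unit.
  move=> a0; apply: fraction_field_unit frD _.
  by apply: contraNneq a0 => /(frobenius_inj FE) ->.
have [Fr FrE] := fraction_extension frK iDF_unit.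
exists Fr; split=> // k _ D' iD' frD'.
have qkP := seed_equiv_prim qdP s0s k.
have [g gA gE] := mutation_morphism qkP frD.
split.
  have [mu muE] := fraction_extension frD' (mutation_inj qkP frD gA gE).
  exists mu; split=> [c|i]; rewrite muE ?gA // gE.
  exact: mut_image_delta.
move=> mu [muA muX] i.
have mu_g : (mu \o iD')%FUN =1 g.
  apply: (qtorus_ext (@epsh_skew (mutate k))) => [c|j] /=; first by rewrite muA gA.
  by rewrite muX gE mut_image_delta.
rewrite -[LHS]/((mu \o iD')%FUN _) mu_g qEXn; last exact: (@epsh_skew (mutate k)).
rewrite gE mut_image_frobenius // slope_delta; last first.
  by move=> /(epsP _ s0s)/odd_of_coprimez.
rewrite cmutE // rmorphM FrE /= FE; congr (_ * _).
rewrite rmorphXz; last first.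
  rewrite unitfE -(rmorph1 iK) -rmorphD -(rmorph0 iK) (inj_eq iK_inj).
  by rewrite -[lY R k]scale1r one_plus_monomial_neq0 ?qdelta_neq0.
by rewrite rmorphD rmorph1 FrE /= /lY /qX FE.
Qed.
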